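(* Let $m,\ell$ be positive integers, and let $x$ be an element of $G(m,\ell)$. If $x$ lies in its own super-summit set, then $x$ is rigid or periodic.
   Context: For positive integers $m,\ell$, consider letters $a_0,\ldots,a_{m-1}$ with indices read modulo $m$; for $i\in\mathbb{Z}$, $p\geq 1$ let $s(i,p)=a_ia_{i+1}\cdots a_{i+p-1}$ (a product of $p$ consecutive letters) and let $s(i,0)$ be the empty word. The circular monoid $M(m,\ell)$ is the monoid with generators $a_0,\ldots,a_{m-1}$ and relations $s(i,\ell)=s(i+1,\ell)$ for all $i\in\{0,\ldots,m-1\}$; $G(m,\ell)$ is its enveloping group (the group with the same presentation). It is known that $M(m,\ell)$ is a cancellative monoid, embedded in $G(m,\ell)$, which is a lattice for left-divisibility ($a\preceq b$ if $b=ac$ for some $c$ in the monoid), and that it is a Garside monoid with Garside element $\Delta=s(0,\ell)$. The simple elements are the divisors of $\Delta$, namely the $s(i,p)$ with $0\leq i\leq m-1$, $0\leq p\leq \ell$. Let $S$ be the set of simple elements and $\wedge$ the left-gcd. A word $s_1\cdots s_r$ in $S$ is greedy if $s_j=(s_js_{j+1})\wedge\Delta$ for $1\leq j<r$. Every $x\in G(m,\ell)$ has a unique left-weighted factorization $x=\Delta^ks_1\cdots s_r$ with $k\in\mathbb{Z}$, $r\geq 0$, $s_j\in S\setminus\{1,\Delta\}$ and $s_1\cdots s_r$ greedy. One sets $\inf(x)=k$ and $\sup(x)=k+r$. The super-summit set of $x$ is the (finite, nonempty) set of conjugates of $x$ which have simultaneously maximal $\inf$ and minimal $\sup$ among all conjugates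 of $x$. Let $\phi(g)=\Delta^{-1}g\Delta$. If $r\geq 1$, set $\mathrm{init}(x)=\phi^{-k}(s_1)$ and $\mathrm{fin}(x)=s_r$. The element $x$ is rigid if $r=0$ or if the two-letter word $\mathrm{fin}(x)\,\mathrm{init}(x)$ is greedy. The element $x$ is periodic if $x^p=\Delta^q$ for some integers $p,q$ with $p\neq 0$. *)

(* Defs.v *)
From HB Require Import structures.
From mathcomp Require Import all_boot all_order all_algebra.
From mathcomp Require Import boolp classical_sets.

Set Implicit Arguments.
Unset Strict Implicit.
Unset Printing Implicit Defensive.

Local Open Scope quotient_scope.
Local Open Scope group_scope.

(* Presented monoids: [pres_monoid R] is < A | s = t for R s t >, the quotient
   of the free monoid [seq A] by the congruence generated by R. *)

Section PresentedMonoid.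
Variables (A : choiceType) (R : seq A -> seq A -> Prop).

Inductive pres_cong : seq A -> seq A -> Prop :=
| PresRefl u : pres_cong u u
| PresSym u v : pres_cong u v -> pres_cong v u
| PresTrans v u w : pres_cong u v -> pres_cong v w -> pres_cong u w
| PresRel u s t v : R s t -> pres_cong (u ++ s ++ v) (u ++ t ++ v).

Lemma pres_cong_cat u1 u2 v1 v2 :
  pres_cong u1 u2 -> pres_cong v1 v2 -> pres_cong (u1 ++ v1) (u2 ++ v2).
Proof.
have catl w v v' : pres_cong v v' -> pres_cong (w ++ v) (w ++ v').
  elim=> [u|u u' _ IH|u u' u'' _ IH1 _ IH2|u s t u' Rst].
  - exact: PresRefl.
  - exact: PresSym.
  - exact: PresTrans IH1 IH2.
  - by rewrite ![w ++ u ++ _]catA; apply: PresRel.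
have catr w v v' : pres_cong v v' -> pres_cong (v ++ w) (v' ++ w).
  elim=> [u|u u' _ IH|u u' u'' _ IH1 _ IH2|u s t u' Rst].
  - exact: PresRefl.
  - exact: PresSym.
  - exact: PresTrans IH1 IH2.
  - by rewrite -!catA; apply: PresRel.
by move=> /(catr v1) H1 /(catl u2) H2; apply: PresTrans H1 H2.
Qed.

Definition pres_congb : rel (seq A) := fun u v => `[< pres_cong u v >].

Lemma pres_congb_refl : reflexive pres_congb.
Proof. by move=> u; apply/asboolP/PresRefl. Qed.

Lemma pres_congb_sym : symmetric pres_congb.
Proof. by move=> u v; apply/asboolP/asboolP => /PresSym. Qed.

Lemma pres_congb_trans : transitive pres_congb.
Proof. by move=> v u w /asboolP H1 /asboolP H2; apply/asboolP/(PresTrans H1). Qed.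

Canonical pres_equiv :=
  EquivRel pres_congb pres_congb_refl pres_congb_sym pres_congb_trans.

Definition pres_monoid := {eq_quot pres_equiv}.
HB.instance Definition _ := Choice.on pres_monoid.
HB.instance Definition _ := Quotient.on pres_monoid.

Lemma pres_monoidP u v : \pi_pres_monoid u = \pi_pres_monoid v <-> pres_cong u v.
Proof.
by split=> [/eqmodP/asboolP //|Huv]; apply/eqmodP/asboolP.
Qed.

Lemma pres_repr u : pres_cong (repr (\pi_pres_monoid u)) u.
Proof. by apply/pres_monoidP; rewrite reprK. Qed.

Definition pres_one : pres_monoid := \pi_pres_monoid [::].
Definition pres_mul (x y : pres_monoid) : pres_monoid := \pi_pres_monoid (repr x ++ repr y).

Lemma pres_mul_pi u v :
  pres_mul (\pi_pres_monoid u) (\pi_pres_monoid v) = \pi_pres_monoid (u ++ v).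
Proof. by apply/pres_monoidP/pres_cong_cat; apply: pres_repr. Qed.

Lemma pres_mulA : associative pres_mul.
Proof.
move=> x y z; rewrite -[x]reprK -[y]reprK -[z]reprK.
move: (repr x) (repr y) (repr z) => u v w.
rewrite (pres_mul_pi u v) (pres_mul_pi v w).
by rewrite (pres_mul_pi u (v ++ w)) (pres_mul_pi (u ++ v) w) catA.
Qed.

Lemma pres_mul1 : left_id pres_one pres_mul.
Proof. by move=> x; rewrite -[x]reprK (pres_mul_pi [::] (repr x)). Qed.

Lemma pres_mulr1 : right_id pres_one pres_mul.
Proof. by move=> x; rewrite -[x]reprK (pres_mul_pi (repr x) [::]) cats0. Qed.

HB.instance Definition _ :=
  isMonoid.Build pres_monoid pres_mulA pres_mul1 pres_mulr1.

Lemma pres_piM u v :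
  \pi_pres_monoid (u ++ v) = (\pi_pres_monoid u * \pi_pres_monoid v)%g.
Proof. by rewrite [RHS]pres_mul_pi. Qed.

End PresentedMonoid.

(* The group with the same presentation: (a, false) stands for the generator a
   and (a, true) for its inverse. *)

Section PresentedGroup.
Variables (A : choiceType) (R : seq A -> seq A -> Prop).

Definition pos_word (s : seq A) : seq (A * bool) := [seq (a, false) | a <- s].

Inductive group_rel : seq (A * bool) -> seq (A * bool) -> Prop :=
| GroupRel s t : R s t -> group_rel (pos_word s) (pos_word t)
| GroupInv a b : group_rel [:: (a, b); (a, ~~ b)] [::].

Definition pres_group := pres_monoid group_rel.
HB.instance Definition _ := Monoid.on pres_group.
HB.instance Definition _ := Quotient.on pres_group.

Definition inv_word (w : seq (A * bool)) := rev [seq (p.1, ~~ p.2) | p <- w].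

Lemma inv_wordK : involutive inv_word.
Proof.
move=> w; rewrite /inv_word map_rev revK -map_comp -[RHS]map_id.
by apply: eq_map => -[a b] /=; rewrite negbK.
Qed.

Lemma inv_word_cong w : pres_cong group_rel (w ++ inv_word w) [::].
Proof.
elim: w => [|[a b] w IH]; first exact: PresRefl.
rewrite /inv_word /= rev_cons -cats1 -/(inv_word w).
have H := pres_cong_cat (PresRefl group_rel [:: (a, b)])
  (pres_cong_cat IH (PresRefl group_rel [:: (a, ~~ b)])).
rewrite -catA in H; apply: PresTrans H _.
by have := PresRel [::] [::] (GroupInv a b).
Qed.

Definition pres_inv (x : pres_group) : pres_group := \pi_pres_group (inv_word (repr x)).

Lemma pres_mulV : right_inverse 1%g pres_inv ( *%g : pres_group -> pres_group -> pres_group).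
Proof.
move=> x; rewrite -{1}[x]reprK -[LHS]pres_piM.
exact/pres_monoidP/inv_word_cong.
Qed.

Lemma pres_Vmul : left_inverse 1%g pres_inv ( *%g : pres_group -> pres_group -> pres_group).
Proof.
move=> x; rewrite -{2}[x]reprK -[LHS]pres_piM.
by apply/pres_monoidP; rewrite -{2}[repr x]inv_wordK; apply: inv_word_cong.
Qed.

HB.instance Definition _ := hasInv.Build pres_group pres_inv.
HB.instance Definition _ := Monoid_isGroup.Build pres_group pres_Vmul pres_mulV.

Definition to_group (u : pres_monoid R) : pres_group := \pi_pres_group (pos_word (repr u)).

Lemma pos_word_cong s t :
  pres_cong R s t -> pres_cong group_rel (pos_word s) (pos_word t).
Proof.
elim=> [u|u u' _ IH|u u' u'' _ IH1 _ IH2|u s1 t1 u' Rst].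
- exact: PresRefl.
- exact: PresSym.
- exact: PresTrans IH1 IH2.
- by rewrite /pos_word !map_cat; apply/PresRel/GroupRel.
Qed.

Lemma to_group_pi s : to_group (\pi_(pres_monoid R) s) = \pi_pres_group (pos_word s).
Proof. exact/pres_monoidP/pos_word_cong/pres_repr. Qed.

Lemma to_group_monoid_morphism : monoid_morphism to_group.
Proof.
split=> [|x y]; first exact: to_group_pi.
rewrite -[x]reprK -[y]reprK -pres_piM !to_group_pi.
by rewrite /pos_word map_cat; apply: pres_piM.
Qed.

HB.instance Definition _ :=
  isUMagmaMorphism.Build (pres_monoid R) pres_group to_group
    to_group_monoid_morphism.

End PresentedGroup.

Definition expgz (G : groupType) (x : G) (n : int) : G :=
  match n with Posz k => x ^+ k | Negz k => x ^- k.+1 end.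

(* The letters are the i : 'I_m, and ordS is the successor modulo m: [sword i p]
   is the word a_i a_(i+1) ... a_(i+p-1), with indices modulo m. *)
Definition sword (m : nat) (i : 'I_m) (p : nat) : seq 'I_m :=
  traject (@ordS m) i p.

Definition circular_rel (m l : nat) (u v : seq 'I_m) : Prop :=
  exists i : 'I_m, u = sword i l /\ v = sword (ordS i) l.

Definition circular_monoid (m l : nat) := pres_monoid (@circular_rel m l).
HB.instance Definition _ m l := Monoid.on (circular_monoid m l).
HB.instance Definition _ m l := Quotient.on (circular_monoid m l).

Definition circular_group (m l : nat) := pres_group (@circular_rel m l).
HB.instance Definition _ m l := Group.on (circular_group m l).
HB.instance Definition _ m l := Quotient.on (circular_group m l).

Section Garside.
(* The number of letters is m.+1, so that there is a letter a_0. *)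
Variables m l : nat.
Local Notation M := (circular_monoid m.+1 l).
Local Notation G := (circular_group m.+1 l).
Implicit Types (x y a b d g : G) (w : seq G).

Definition incl : M -> G := @to_group _ (@circular_rel m.+1 l).
HB.instance Definition _ :=
  isUMagmaMorphism.Build M G incl (@to_group_monoid_morphism _ _).

Definition Delta : G := incl (\pi_M (sword ord0 l)).

Definition ldiv a b : Prop := exists c : M, b = a * incl c.

(* As M is a Garside monoid, left and right divisors of Delta coincide. *)
Definition simple_elt a : Prop := (exists u : M, a = incl u) /\ ldiv a Delta.

(* d is the left-gcd of a and b. *)
Definition is_lgcd a b d : Prop :=
  [/\ ldiv d a, ldiv d b & forall c, ldiv c a -> ldiv c b -> ldiv c d].

Definition greedy w : Prop :=
  (forall a, a \in w -> simple_elt a) /\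
  (forall j, j.+1 < size w ->
     is_lgcd (nth 1 w j * nth 1 w j.+1) Delta (nth 1 w j)).

Definition left_weighted x (kw : int * seq G) : Prop :=
  [/\ x = expgz Delta kw.1 * \prod_(s <- kw.2) s,
      forall s, s \in kw.2 -> [/\ simple_elt s, s <> 1 & s <> Delta]
    & greedy kw.2].

(* The left-weighted factorization exists and is unique when 0 < l. *)
Definition lwf x : int * seq G := xget (0%R, [::]) [set kw | left_weighted x kw].

Definition ginf x : int := (lwf x).1.
Definition gsup x : int := ((lwf x).1 + (size (lwf x).2)%:Z)%R.

Definition conjugate x y : Prop := exists g, y = x ^ g.

Definition super_summit_set x : set G :=
  [set y | conjugate x y /\
     forall z, conjugate x z -> (ginf z <= ginf y)%R /\ (gsup y <= gsup z)%R].

(* The n-th power of phi : g |-> Delta^-1 g Delta, where g ^ h is h^-1 g h. *)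
Definition phi_pow (n : int) g : G := g ^ expgz Delta n.

Definition init x : G := phi_pow (- ginf x)%R (head 1 (lwf x).2).
Definition fin x : G := last 1 (lwf x).2.

Definition rigid x : Prop := (lwf x).2 = [::] \/ greedy [:: fin x; init x].

Definition periodic x : Prop :=
  exists p q : int, p <> 0%R /\ expgz x p = expgz Delta q.

End Garside.

(* Main.v *)
Require Import Defs.
From mathcomp Require Import all_boot all_order all_algebra zify.
From mathcomp Require Import boolp classical_sets.

(** Let L be the length of Delta, and call a run a word s(i,p) of consecutive
    letters.  The proof has two halves.

    The first half is a solution of the word problem.  In the group,
    s(i,L) = Delta and a_i Delta = Delta a_(i+L), so every element can be
    written Delta^k w with w a word in the letters containing no run of length
    L.  Such a pair (k, w) is unique: the letters and their inverses act on the
    set of these pairs ([push]), this action respects the defining relations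
    ([act_cong]), and the pair of x is recovered by letting x act on (0, empty
    word).  Consequently the elements of the monoid are those with k >= 0
    ([in_monoidP]), the simple elements are the runs ([simple_eltP]), and for
    proper nonempty runs the two-letter word s(i,p) s(j,q) is greedy exactly
    when j is not i+p ([is_lgcd_run]).  A left-weighted factorization is
    thus nothing but the decomposition of a reduced word w into its maximal
    runs, so that inf and sup can be read on any such decomposition
    ([inf_sup_runs_elt]).

    The second half is the geometric argument.  Write
    x = Delta^k s_1 ... s_r with s_1 = s(i,p) and s_r = s(j,q), and suppose
    that x is not rigid: the run s_r, moved cyclically to the front, ends where
    s_1 begins.  If r >= 2, conjugating x by s_r fuses the two into one run of
    length p+q.  When p+q < L the number of factors drops and sup decreases;
    when p+q >= L a factor Delta splits off and inf increases.  In both cases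
    the remaining word is still greedy, and x is not in its super-summit set
    ([cyclic_merge]).  If r = 1, the run s(i,p) closes up on itself, the
    factors of every power of x fuse into a single run, and
    x^L = Delta^(kL+p) ([periodic_single_run]). *)

Set Implicit Arguments.
Unset Strict Implicit.
Unset Printing Implicit Defensive.

Import GRing.Theory.
Local Open Scope quotient_scope.
Local Open Scope group_scope.

(** * Words without a full run *)

Section Words.
Variables m l : nat.
Local Notation L := l.+1.
Local Notation letter := 'I_m.+1.
Implicit Types (i j : letter) (w t u : seq letter) (k : int) (n p q : nat).

Lemma ordS_add i : ordS i = (i + inZp 1)%R.
Proof. by apply: val_inj; rewrite /= modnDmr addn1. Qed.

Lemma iter_ordS n i : iter n (@ordS m.+1) i = (i + inZp 1 *+ n)%R.
Proof.
elim: n => [|n IH]; first by rewrite /= mulr0n addr0.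
by rewrite iterS IH ordS_add mulrSr addrA.
Qed.

(** The action of conjugation by [Delta ^ k] on the indices of the letters. *)
Definition twist k i : letter := (i + (inZp 1 *+ L) *~ k)%R.

Lemma twist0 i : twist 0 i = i.
Proof. by rewrite /twist mulr0z addr0. Qed.

Lemma map_twist0 w : map (twist 0) w = w.
Proof. by rewrite -[RHS]map_id; apply: eq_map => j; rewrite twist0. Qed.

Lemma twistD k k' i : twist (k + k') i = twist k (twist k' i).
Proof. by rewrite /twist mulrzDr -addrA; congr (_ + _)%R; rewrite addrC. Qed.

Lemma twist1 i : twist 1 i = iter L (@ordS m.+1) i.
Proof. by rewrite iter_ordS /twist mulr1z. Qed.

Lemma twist_ordS k i : twist k (ordS i) = ordS (twist k i).
Proof. by rewrite /twist !ordS_add addrAC. Qed.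

Lemma twist_iter k n i :
  twist k (iter n (@ordS m.+1) i) = iter n (@ordS m.+1) (twist k i).
Proof. by elim: n => //= n IH; rewrite twist_ordS IH. Qed.

Lemma map_twist_sword k i n : map (twist k) (sword i n) = sword (twist k i) n.
Proof. by rewrite /sword; elim: n i => //= n IH i; rewrite IH twist_ordS. Qed.

Lemma size_sword i n : size (sword i n) = n.
Proof. exact: size_traject. Qed.

Lemma swordD i n p :
  sword i (n + p) = sword i n ++ sword (iter n (@ordS m.+1) i) p.
Proof. exact: trajectD. Qed.

Definition starts w i := ohead w == Some i.

Lemma startsP w i : reflect (exists t, w = i :: t) (starts w i).
Proof.
apply: (iffP eqP) => [|[t -> //]].
by case: w => // j t [->]; exists t.
Qed.

(** No run of [L] letters occurs: it is enough to look at prefixes of suffixes. *)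
Fixpoint reduced w : bool :=
  if w is i :: t then ~~ prefix (sword (ordS i) l) t && reduced t else true.

(** A run that is a prefix of [x :: u ++ v] and goes beyond [x :: u] has to
    continue the last letter of [x :: u] by the first letter of [v]. *)
Lemma prefix_sword_cat n x u v :
  prefix (sword (ordS x) n) (u ++ v) ->
  prefix (sword (ordS x) n) u || starts v (ordS (last x u)).
Proof.
elim: u n x => [|y u IH] [|n] x //=.
  by case: v => [|j v] //= /andP[/eqP-> _]; rewrite /starts /= eqxx.
by case/andP=> /eqP <- /IH; rewrite eqxx.
Qed.

Lemma reduced_cat x u v :
  reduced (x :: u) -> reduced v -> ~~ starts v (ordS (last x u)) ->
  reduced ((x :: u) ++ v).
Proof.
elim: u x => [|y u IH] x /andP[pre_u red_u] red_v brk; apply/andP; split.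
- apply: contra pre_u => /(@prefix_sword_cat l x [::] v).
  by rewrite (negbTE brk) orbF.
- by [].
- apply: contra pre_u => /(@prefix_sword_cat l x (y :: u) v).
  by rewrite (negbTE brk) orbF.
- exact: IH.
Qed.

Lemma reduced_run i n : n < L -> reduced (sword i n).
Proof.
elim: n i => //= n IH i lt_nL; rewrite {}IH 1?ltnW // andbT.
by apply/negP=> /size_prefix; rewrite !size_sword leqNgt -ltnS lt_nL.
Qed.

Lemma reduced_sword i n w :
  n < L -> reduced w -> ~~ starts w (iter n (@ordS m.+1) i) ->
  reduced (sword i n ++ w).
Proof.
case: n => // n lt_nL red_w brk; apply: reduced_cat => //.
  exact: (@reduced_run i n.+1).
by rewrite last_traject -iterS.
Qed.

Lemma longest_run i w : exists n t,
  w = sword i n ++ t /\ ~~ starts t (iter n (@ordS m.+1) i).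
Proof.
elim: w i => [|j w IH] i; first by exists 0, [::].
have [->|ne_ji] := eqVneq j i.
  have [n [t [-> brk]]] := IH (ordS i).
  by exists n.+1, t; split=> //; rewrite iterSr.
by exists 0, (j :: w); split=> //; apply: contra ne_ji => /eqP[->].
Qed.

Lemma reduced_run_lt i n t : reduced (sword i n ++ t) -> n < L.
Proof.
move=> red; rewrite ltnNge; apply: contraTN red => le_Ln.
rewrite -(subnKC le_Ln) swordD -catA /=.
by rewrite prefix_prefix.
Qed.

Lemma reduced_drop n w : reduced w -> reduced (drop n w).
Proof. by elim: w n => //= i w IH [|n] //= /andP[_ /IH]. Qed.

Lemma reduced_behead w : reduced w -> reduced (behead w).
Proof. by case: w => //= i w /andP[]. Qed.

Local Notation state := (int * seq letter)%type.
Implicit Types st : state.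

(** * The action on normal forms *)

(** The pair [(k, w)] stands for [Delta ^ k * w].  Moving the letter [a.1] across
    [Delta ^ k] twists its index into [i].  A letter that completes a run of
    length [L] turns this run into one more [Delta].  The inverse of [i] cancels
    a leading [i], and otherwise is rewritten through
    [a_i^-1 = Delta^-1 s(i+1-L, L-1)]. *)
Definition push (a : letter * bool) st : state :=
  let: (k, w) := st in
  let i := twist k a.1 in
  if a.2 then
    if starts w i then (k, behead w)
    else ((k - 1)%R, sword (twist (-1) (ordS i)) l ++ w)
  else
    if prefix (sword (ordS i) l) w then ((k + 1)%R, drop l w) else (k, i :: w).

Definition act (v : seq (letter * bool)) st : state := foldr push st v.

Lemma act_cat (u v : seq (letter * bool)) st : act (u ++ v) st = act u (act v st).
Proof. exact: foldr_cat. Qed.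

Lemma iter_twistN i : iter l (@ordS m.+1) (twist (-1) (ordS i)) = i.
Proof. by rewrite -twist_iter -iterSr -twist1 -twistD addNr twist0. Qed.

Lemma reduced_push a st : reduced st.2 -> reduced (push a st).2.
Proof.
case: st a => k w [i []] /= red_w.
  case: ifP => brk /=; first exact: reduced_behead.
  by rewrite reduced_sword ?iter_twistN ?brk.
by case: ifP => brk /=; rewrite ?reduced_drop ?brk.
Qed.

Lemma reduced_act v st : reduced st.2 -> reduced (act v st).2.
Proof. by move=> red_st; elim: v => //= a v; apply: reduced_push. Qed.

(** Reducedness matters here: it excludes that [i^-1] cancels the letter that
    follows a run just turned into [Delta]. *)
Lemma push_inv a b st : reduced st.2 -> push (a, b) (push (a, ~~ b) st) = st.
Proof.
case: st b => k w [] /= red_w.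
  case: (boolP (prefix _ w)) => [/prefixP[t def_w]|] /=; last first.
    by rewrite /starts /= eqxx.
  have brk: starts t (twist (k + 1) a) = false.
    apply: contraTF red_w => /startsP[t' def_t].
    rewrite def_w def_t addrC twistD twist1 iterSr -cat_rcons.
    have -> : rcons (sword (ordS (twist k a)) l)
                    (iter l (@ordS m.+1) (ordS (twist k a))) =
              sword (ordS (twist k a)) L by rewrite /sword trajectSr.
    by rewrite /= prefix_prefix.
  rewrite def_w drop_size_cat ?size_sword // brk twist_ordS -twistD.
  have -> : (k + 1 - 1 = k)%R by lia.
  by have -> : (-1 + (k + 1) = k)%R by lia.
case: (boolP (starts w _)) => [/startsP[t def_w]|brk] /=.
  by move: red_w; rewrite def_w /= => /andP[/negbTE-> _].
rewrite addrC twistD -twist_ordS prefix_prefix.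
have -> : (-1 + k + 1 = k)%R by lia.
by rewrite drop_size_cat ?size_sword.
Qed.

Lemma act_reduced u k w :
  reduced (map (twist k) u ++ w) ->
  act (pos_word u) (k, w) = (k, map (twist k) u ++ w).
Proof. by elim: u => //= i u IH /andP[/negbTE brk /IH->] /=; rewrite brk. Qed.

Lemma act_sword_reduced i n k w :
  reduced w -> n < L -> ~~ starts w (iter n (@ordS m.+1) (twist k i)) ->
  act (pos_word (sword i n)) (k, w) = (k, sword (twist k i) n ++ w).
Proof.
by move=> *; rewrite act_reduced map_twist_sword // reduced_sword.
Qed.

(** The case of the defining relations: every [s(i,L)] acts as [Delta].  If [w]
    starts with a run of length [p] continuing [s(i,L)], the last [L - p]
    letters of [s(i,L)] complete this run, and the first [p] letters rebuild it
    behind the new [Delta]. *)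
Lemma act_full_run i k w :
  reduced w -> act (pos_word (sword i L)) (k, w) = ((k + 1)%R, w).
Proof.
move=> red_w.
have [p [t [def_w brk]]] := longest_run (twist (k + 1) i) w.
have lt_pL: p < L by move: red_w; rewrite def_w; apply: reduced_run_lt.
have red_t: reduced t.
  have ->: t = drop p w by rewrite def_w drop_size_cat ?size_sword.
  exact: reduced_drop.
have def_wL: w = sword (iter L (@ordS m.+1) (twist k i)) p ++ t.
  by rewrite def_w addrC twistD twist1.
rewrite -{1}(subnKC lt_pL) addSnnS swordD /pos_word map_cat act_cat subSS.
rewrite -/(pos_word _) /=.
set i' := iter p _ i.
have def_run : sword (ordS (twist k i')) (l - p) ++ w =
    sword (ordS (twist k i')) l ++ t.
  rewrite def_wL catA -[in RHS](subnK (_ : p <= l)) // swordD.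
  congr ((_ ++ sword _ _) ++ _).
  by rewrite /i' twist_iter -iterSr -iterD addSn subnK.
rewrite -/(sword _ _) -/(pos_word _) act_reduced; last first.
  rewrite map_twist_sword twist_ordS def_run reduced_sword //.
  rewrite -iterSr /i' twist_iter -iterD addnC iterD.
  by move: brk; rewrite addrC twistD twist1.
rewrite map_twist_sword twist_ordS def_run /= prefix_prefix.
by rewrite drop_size_cat ?size_sword // act_sword_reduced // -def_w.
Qed.

Lemma act_cong (u v : seq (letter * bool)) :
  pres_cong (group_rel (@circular_rel m.+1 L)) u v ->
  forall st, reduced st.2 -> act u st = act v st.
Proof.
elim=> // [u1 v1 _ IH|u1 v1 w1 _ IH1 _ IH2|u1 s t u2 rel] st red_st.
- by rewrite IH.
- by rewrite IH1 ?IH2.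
rewrite !act_cat; congr (act _ _).
have: reduced (act u2 st).2 by apply: reduced_act.
move: (act u2 st) => [k w] red_w.
case: rel => [_ _ [i [-> ->]]|a b]; first by rewrite !act_full_run.
exact: push_inv.
Qed.

(** A positive word never lowers the power of [Delta]; if it does not raise it, no
    reduction took place and the word is visible in the result. *)
Lemma act_pos_le u k w (st := act (pos_word u) (k, w)) :
  (k <= st.1)%R /\ (st.1 = k -> st.2 = map (twist k) u ++ w).
Proof.
rewrite {}/st; elim: u => //= i u [].
case: (act _ _) => k' w' /= le_k def_w'.
case: ifP => _ /=; first by split=> [|eq_k]; lia.
by split=> // eq_k; rewrite def_w' ?eq_k.
Qed.

(** The defining relations are homogeneous, which makes length a degree. *)
Lemma act_pos_degree u k w (st := act (pos_word u) (k, w)) :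
  (st.1 * L%:Z + (size st.2)%:Z = k * L%:Z + (size w + size u)%:Z)%R.
Proof.
rewrite {}/st; elim: u => [|i u] /=; first by rewrite addn0.
case: (act _ _) => k' w' /= IH.
case: ifP => [/prefixP[t def_w']|_] /=; last by lia.
move: IH; rewrite def_w' drop_size_cat ?size_cat size_sword //; lia.
Qed.

(** The number of maximal runs of a word, counted by their last letters. *)
Fixpoint nb_runs w :=
  if w is i :: t then ~~ starts t (ordS i) + nb_runs t else 0.

Lemma nb_runs_sword i n w :
  ~~ starts w (iter n.+1 (@ordS m.+1) i) ->
  nb_runs (sword i n.+1 ++ w) = (nb_runs w).+1.
Proof.
elim: n i => [|n IH] i brk; first by rewrite /= brk.
by rewrite -(IH (ordS i)) -?iterSr //= /starts /= eqxx.
Qed.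

End Words.

(** * Integer powers *)

Section IntegerPowers.
Variable H : groupType.
Implicit Types (x : H) (k : int).

Lemma expgzS x k : expgz x (k + 1) = expgz x k * x.
Proof.
case: k => [n|[|n]].
- by rewrite -PoszD addn1 /= expgSr.
- by rewrite /= expg1 mulVg.
have -> : (Negz n.+1 + 1 = Negz n)%R by lia.
by rewrite /= (expgS x n.+1) invgM mulgVK.
Qed.

Lemma expgzP x k : expgz x (k - 1) = expgz x k * x^-1.
Proof. by rewrite -{2}[k](_ : k - 1 + 1 = k)%R ?expgzS ?mulgK //; lia. Qed.

Lemma expgzD x k k' : expgz x (k + k') = expgz x k * expgz x k'.
Proof.
elim/int_ind: k' => [|n IH|n IH].
- by rewrite (_ : k + 0 = k)%R ?mulg1 //; lia.
- rewrite -(addn1 n) PoszD expgzS mulgA -IH -expgzS; congr expgz; lia.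
- rewrite -(addn1 n) PoszD opprD expgzP mulgA -IH -expgzP; congr expgz; lia.
Qed.

End IntegerPowers.

(** * Runs in the circular group *)

Section Group.
Variables m l : nat.
Local Notation L := l.+1.
Local Notation letter := 'I_m.+1.
Local Notation M := (circular_monoid m.+1 L).
Local Notation G := (circular_group m.+1 L).
Local Notation Delta := (Delta m L).
Implicit Types (i j : letter) (w t u : seq letter) (k : int) (n p q : nat).
Implicit Types (x y z a b : G).

Lemma pi_cat (u v : seq (letter * bool)) :
  \pi_G (u ++ v) = \pi_G u * \pi_G v.
Proof. exact: pres_piM. Qed.

Definition act_elt x (st : int * seq letter) := act l (repr x) st.

Lemma act_elt_pi v st :
  reduced l st.2 -> act_elt (\pi_G v) st = act l v st.
Proof. by move=> red_st; apply: act_cong red_st; apply: pres_repr. Qed.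

Lemma act_eltM x y st :
  reduced l st.2 -> act_elt (x * y) st = act_elt x (act_elt y st).
Proof.
move=> red_st; rewrite -{1}[x]reprK -{1}[y]reprK.
by rewrite -pi_cat act_elt_pi // act_cat.
Qed.

Lemma act_elt1 st : reduced l st.2 -> act_elt 1 st = st.
Proof. exact: (@act_elt_pi [::]). Qed.

Lemma reduced_act_elt x st : reduced l st.2 -> reduced l (act_elt x st).2.
Proof. exact: reduced_act. Qed.

Lemma incl_pi u : incl (\pi_M u) = \pi_G (pos_word u).
Proof. exact: to_group_pi. Qed.

Lemma act_elt_incl (c : M) st :
  reduced l st.2 -> act_elt (incl c) st = act l (pos_word (repr c)) st.
Proof. by rewrite -{1}[c]reprK incl_pi; apply: act_elt_pi. Qed.

Definition run i p : G := incl (\pi_M (sword i p)).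

Lemma act_elt_run i p st :
  reduced l st.2 -> act_elt (run i p) st = act l (pos_word (sword i p)) st.
Proof. by rewrite /run incl_pi; apply: act_elt_pi. Qed.

Lemma incl_cat u v : incl (\pi_M (u ++ v)) = incl (\pi_M u) * incl (\pi_M v).
Proof. by rewrite [\pi_M (u ++ v)]pres_piM gmulfM. Qed.

Lemma run0 i : run i 0 = 1.
Proof. exact: (@gmulf1 _ _ (@incl m L)). Qed.

Lemma runD i n p : run i (n + p) = run i n * run (iter n (@ordS m.+1) i) p.
Proof. by rewrite /run swordD incl_cat. Qed.

Lemma run_full i : run i L = Delta.
Proof.
have step j : run j L = run (ordS j) L.
  rewrite /run; congr incl; apply/pres_monoidP.
  have rel : circular_rel L (sword j L) (sword (ordS j) L) by exists j.
  by have := PresRel [::] [::] rel; rewrite !cats0.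
have iter_ord0 n : n < m.+1 -> iter n (@ordS m.+1) ord0 = n :> nat.
  by elim: n => //= n IH lt_n; rewrite IH ?modn_small // ltnW.
have -> : i = iter i (@ordS m.+1) ord0 by apply: val_inj; rewrite /= iter_ord0.
by elim: (nat_of_ord i) => [|n IH] //; rewrite iterS -step.
Qed.

Lemma runJ1 i p : run i p ^ Delta = run (twist l 1 i) p.
Proof.
apply: (@mulgI _ Delta); rewrite -conjgC twist1.
by rewrite -{2}(run_full i) -runD addnC runD run_full.
Qed.

Lemma runJ i p k : run i p ^ expgz Delta k = run (twist l k i) p.
Proof.
elim/int_ind: k => [|n IH|n IH].
- by rewrite conjg1 twist0.
- rewrite -(addn1 n) PoszD expgzS conjgM IH runJ1 -twistD.
  congr (run (twist _ _ _) _); lia.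
- rewrite -(addn1 n) PoszD opprD expgzP conjgM IH.
  apply: (canLR (conjgK _)); rewrite runJ1 -twistD.
  congr (run (twist _ _ _) _); lia.
Qed.

Lemma act_elt_Delta k w : reduced l w -> act_elt Delta (k, w) = ((k + 1)%R, w).
Proof. by move=> red_w; rewrite -(run_full ord0) act_elt_run ?act_full_run. Qed.

Lemma act_elt_expgz k k' w :
  reduced l w -> act_elt (expgz Delta k) (k', w) = ((k' + k)%R, w).
Proof.
move=> red_w; elim/int_ind: k k' => [|n IH|n IH] k'.
- by rewrite act_elt1 //; congr pair; lia.
- rewrite -(addn1 n) PoszD expgzS act_eltM // act_elt_Delta // IH.
  by congr pair; lia.
- rewrite -(addn1 n) PoszD opprD expgzP act_eltM //.
  have -> : act_elt Delta^-1 (k', w) = ((k' - 1)%R, w).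
    rewrite -[k' in LHS](_ : k' - 1 + 1 = k')%R; last by lia.
    by rewrite -act_elt_Delta // -act_eltM // mulVg act_elt1.
  by rewrite IH; congr pair; lia.
Qed.

Lemma ldiv_run i n p : n <= p -> ldiv (run i n) (run i p).
Proof.
move=> /subnKC <-; exists (\pi_M (sword (iter n (@ordS m.+1) i) (p - n))).
exact: runD.
Qed.

Lemma simple_run i p : p <= L -> simple_elt (run i p).
Proof.
move=> le_pL; split; first by exists (\pi_M (sword i p)).
by rewrite -(run_full i); apply: ldiv_run.
Qed.

(** If [u c = Delta] in the group, the word [u c] has length [L].  Its letters but
    the first are too few for a reduction, so its normal form being [Delta] forces
    the whole word to be a run. *)
Lemma simple_eltP a : simple_elt a -> exists i p, p <= L /\ a = run i p.
Proof.
case=> -[u0 ->] [c0 def_Delta].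
rewrite -[u0]reprK; rewrite -[u0]reprK -[c0]reprK in def_Delta.
move: (repr u0) (repr c0) def_Delta => u c.
rewrite -incl_cat incl_pi => def_Delta.
have def_act : act l (pos_word (u ++ c)) (0%R, [::]) = (1%R, [::]).
  by rewrite -act_elt_pi // -def_Delta act_elt_Delta.
have size_uc : size (u ++ c) = L.
  by have := act_pos_degree l (u ++ c) 0 [::]; rewrite def_act /=; lia.
suff [i def_uc] : exists i, u ++ c = sword i L.
  exists i, (size u); have le_uL : size u <= L by rewrite -size_uc size_cat leq_addr.
  split=> //; congr (incl (\pi_M _)).
  by rewrite /sword -(take_traject _ _ le_uL) -/(sword i L) -def_uc take_size_cat.
case: (u ++ c) def_act size_uc => // i v /=.
have := act_pos_degree l v 0 [::]; have [] := act_pos_le l v 0 [::].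
case: (act _ _ _) => k w /= le_k def_w deg def_push [size_v].
have k0 : k = 0%R.
  move: le_k deg size_v => /= le_k deg size_v.
  have [->|k_neq0] := eqVneq k 0%R; first by [].
  have : (0 <= (k - 1) * L%:Z)%R by apply: Num.Theory.mulr_ge0; lia.
  by lia.
move: def_push; rewrite def_w // cats0 k0 twist0.
rewrite map_twist0.
case: ifP => // /prefixP[t def_v] _; exists i.
move: size_v; rewrite def_v size_cat size_sword -[RHS]addn0 => /addnI/size0nil->.
by rewrite cats0.
Qed.

(** The normal form of [x]; its first component is the infimum of [x]. *)
Local Notation nf x := (act_elt x (0%R, [::])).

Lemma nf_run i p : p < L -> nf (run i p) = (0%R, sword i p).
Proof.
by move=> lt_pL; rewrite act_elt_run ?act_sword_reduced ?cats0 ?twist0.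
Qed.

Lemma run_proper i p : 0 < p < L -> run i p <> 1 /\ run i p <> Delta.
Proof.
case/andP=> p_gt0 lt_pL; split=> /(congr1 (fun x => nf x)).
  by rewrite nf_run // act_elt1 // => -[]; case: p p_gt0 {lt_pL}.
by rewrite nf_run // act_elt_Delta.
Qed.

Lemma proper_simple_eltP a : simple_elt a -> a <> 1 -> a <> Delta ->
  exists i p, 0 < p < L /\ a = run i p.
Proof.
case/simple_eltP=> i [p [le_pL ->]] ne1 neD; exists i, p; split=> //.
rewrite lt0n ltn_neqAle le_pL andbT; apply/andP; split; apply/eqP => def_p.
  by apply: ne1; rewrite def_p run0.
by apply: neD; rewrite def_p run_full.
Qed.

Lemma nf_run2 i j p q : 0 < p < L -> 0 < q < L ->
  j != iter p (@ordS m.+1) i ->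
  nf (run i p * run j q) = (0%R, sword i p ++ sword j q).
Proof.
move=> /andP[_ lt_pL] /andP[q_gt0 lt_qL] brk.
rewrite act_eltM // nf_run // act_elt_run ?act_sword_reduced ?twist0 //=.
- by rewrite -[sword j q]cats0 reduced_sword.
- by case: q q_gt0 {lt_qL} => //=.
- by rewrite -[sword j q]cats0 reduced_sword.
Qed.

Definition elt_of_state (st : int * seq letter) : G :=
  expgz Delta st.1 * incl (\pi_M st.2).

(** Pushing a letter is left multiplication by it; hence [elt_of_state] is the
    inverse of the normal form. *)
Lemma elt_of_push (a : letter) st :
  elt_of_state (push l (a, false) st) = run a 1 * elt_of_state st.
Proof.
case: st => k w; rewrite /elt_of_state /=.
have run_shift v : run a 1 * (expgz Delta k * incl (\pi_M v)) =
    expgz Delta k * incl (\pi_M (twist l k a :: v)).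
  rewrite mulgA (conjgC (run a 1)) runJ -mulgA; congr (_ * _).
  by rewrite -[_ :: v](cat1s _ v) incl_cat.
rewrite run_shift; case: ifP => //= /prefixP[t ->].
rewrite drop_size_cat ?size_sword // expgzS -mulgA -(run_full (twist l k a)).
by rewrite -incl_cat.
Qed.

Lemma elt_of_act v st : reduced l st.2 ->
  elt_of_state (act l v st) = \pi_G v * elt_of_state st.
Proof.
move=> red_st; elim: v => [|[a b] v IH] /=.
  by rewrite [\pi_G [::]](_ : _ = 1) ?mul1g.
have pi_run : \pi_G [:: (a, false)] = run a 1 by rewrite /run incl_pi.
rewrite -(cat1s (a, b)) pi_cat -mulgA -IH.
case: b; last by rewrite elt_of_push pi_run.
have pi_inv : \pi_G [:: (a, true)] = (run a 1)^-1.
  apply/esym/mulg1_eq; rewrite -pi_run [LHS]pres_mul_pi.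
  apply/pres_monoidP.
  exact: (PresRel [::] [::] (GroupInv (@circular_rel m.+1 L) a false)).
rewrite pi_inv; apply: (canRL (mulKg _)).
by rewrite -elt_of_push push_inv // reduced_act.
Qed.

Lemma elt_of_nf x : elt_of_state (nf x) = x.
Proof.
rewrite elt_of_act // /elt_of_state mul1g -[RHS]reprK -[RHS]mulg1.
by congr (_ * _); apply: (@gmulf1 _ _ (@incl m L)).
Qed.

Lemma in_monoidP x : (exists c : M, x = incl c) <-> (0 <= (nf x).1)%R.
Proof.
split=> [[c ->]|].
  by rewrite act_elt_incl //; case: (act_pos_le l (repr c) 0 [::]).
rewrite -{2}[x]elt_of_nf /elt_of_state; case: (nf x) => -[k|//] w /= _.
exists ((\pi_M (sword ord0 L)) ^+ k * \pi_M w).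
by rewrite gmulfM gmulfXn.
Qed.

Lemma ldivP a b : ldiv a b <-> (0 <= (nf (a^-1 * b)%g).1)%R.
Proof.
rewrite -in_monoidP; split=> -[c def_c]; exists c.
  by rewrite def_c mulKg.
by rewrite -def_c mulVKg.
Qed.

(** Acting with [x] is acting with the positive part of its normal form and then
    shifting the power of [Delta]. *)
Lemma act_elt_nf x v (st := act l (pos_word (nf x).2) (0%R, v)) :
  reduced l v -> act_elt x (0%R, v) = ((st.1 + (nf x).1)%R, st.2).
Proof.
move=> red_v; rewrite -{1}[x]elt_of_nf act_eltM // incl_pi act_elt_pi // -/st.
by rewrite [st]surjective_pairing act_elt_expgz // reduced_act.
Qed.

Lemma inf_le_mul_incl x (c : M) : ((nf x).1 <= (nf (x * incl c)%g).1)%R.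
Proof.
have red_c : reduced l (nf (incl c)).2 by apply: reduced_act_elt.
have inf_c : (0 <= (nf (incl c)).1)%R by apply/in_monoidP; exists c.
rewrite -[x in X in (_ <= X)%R]elt_of_nf /elt_of_state -mulgA.
rewrite act_eltM ?reduced_act_elt // [nf (_ * _)]surjective_pairing.
rewrite act_elt_expgz ?reduced_act_elt // act_eltM // incl_pi act_elt_pi //.
move: inf_c; case: (nf (incl c)) => k v /= k_ge0.
have [] := act_pos_le l (nf x).2 k v.
by case: (act _ _ (k, v)) => k' v' /= le_kk' _; case: (nf x) => ? ? /=; lia.
Qed.

(** If no reduction occurs when [run i p] is appended to the normal form of [x],
    then none occurs when [run j q] follows, since it does not continue
    [run i p]. *)
Lemma inf_mul_run2 x i j p q : 0 < p < L -> 0 < q < L ->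
  j != iter p (@ordS m.+1) i ->
  (nf (x * run i p)%g).1 = (nf x).1 ->
  (nf (x * (run i p * run j q))%g).1 = (nf x).1.
Proof.
move=> p_proper q_proper brk.
case/andP: (p_proper) (q_proper) => p_gt0 lt_pL /andP[q_gt0 lt_qL].
have red_p : reduced l (sword i p) by apply: reduced_run.
have red_q : reduced l (sword j q) by apply: reduced_run.
have brk_q : ~~ starts (sword j q) (iter p (@ordS m.+1) i).
  by case: q q_gt0 {q_proper lt_qL red_q} => //=.
have red_pq : reduced l (sword i p ++ sword j q) by apply: reduced_sword.
have inf_mul y v : nf y = (0%R, v) -> reduced l v ->
    (nf (x * y)%g).1 = ((act l (pos_word (nf x).2) (0%R, v)).1 + (nf x).1)%R.
  by move=> def_y red_v; rewrite act_eltM // def_y act_elt_nf.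
rewrite (inf_mul _ _ (nf_run i lt_pL)) //.
rewrite (inf_mul _ _ (nf_run2 p_proper q_proper brk)) //.
clear inf_mul; have := reduced_act_elt x
  (isT : reduced l (0%R : int, [::] : seq letter).2).
case: (nf x) => k w /= red_w inf_p.
have [_] := act_pos_le l w 0 (sword i p).
have := reduced_act (pos_word w) (red_p : reduced l (0%R : int, sword i p).2).
move: inf_p; case: (act _ _ (_, sword i p)) => k' w' /= inf_p red_w'.
have -> : k' = 0%R by lia.
move=> /(_ erefl) def_w'; rewrite def_w' map_twist0 in red_w'.
suff red_wpq : reduced l (map (twist l 0) w ++ sword i p ++ sword j q).
  by rewrite act_reduced //=; lia.
rewrite map_twist0 catA.
case def_wp: (w ++ sword i p) => [|a v].
  by case: w p_gt0 def_wp {red_w red_w' def_w'} => //; case: (p).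
apply: reduced_cat => //; first by rewrite -def_wp.
suff -> : last a v = iter p.-1 (@ordS m.+1) i by rewrite -iterS prednK.
have -> : last a v = last i (w ++ sword i p) by rewrite def_wp.
by rewrite last_cat -(prednK p_gt0) /sword /= last_traject.
Qed.

(** The divisors [c] range over the whole group, so a maximality proof inside the
    monoid is not enough.  Let [c] divide both [Delta] and the product.  Then
    [c^-1] has infimum at least [-1]; either [run i p] raises it to a nonnegative
    number, or by [inf_mul_run2] it is already the infimum of [c^-1] times the
    product, which is nonnegative. *)
Lemma is_lgcd_run i j p q : 0 < p < L -> 0 < q < L ->
  is_lgcd (run i p * run j q) Delta (run i p) <->
  j != iter p (@ordS m.+1) i.
Proof.
move=> p_proper q_proper.
case/andP: (p_proper) (q_proper) => p_gt0 lt_pL /andP[q_gt0 lt_qL].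
split=> [[_ _ max_p]|brk].
  (* If the two runs were consecutive, run i p.+1 would be a common divisor,
     but it is too long to divide run i p. *)
  apply/negP=> /eqP def_j.
  have [||d /(congr1 (fun x => (nf x)))] := max_p (run i p.+1).
  - by rewrite def_j -runD; apply: ldiv_run; lia.
  - by rewrite -(run_full i); apply: ldiv_run.
  have red_d := reduced_act_elt (incl d)
    (isT : reduced l (0%R : int, [::] : seq letter).2).
  rewrite nf_run // act_eltM // act_elt_run // act_elt_incl // => def_p.
  have := act_pos_degree l (sword i p.+1) (nf (incl d)).1 (nf (incl d)).2.
  have := act_pos_degree l (repr d) 0 [::].
  rewrite -act_elt_incl // in def_p *; rewrite -surjective_pairing -def_p.
  by rewrite /= !size_sword; lia.
split; first by exists (\pi_M (sword j q)).
  by rewrite -(run_full i); apply: ldiv_run; apply: ltnW.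
move=> c /ldivP c_st [d def_d]; apply/ldivP.
(* c divides Delta, so c^-1 = (incl d) Delta^-1 has infimum at least -1. *)
have inf_c : (-1 <= (nf c^-1%g).1)%R.
  have def_c : incl d = c^-1 * Delta by rewrite def_d mulKg.
  have -> : c^-1 = incl d * expgz Delta (-1) by rewrite def_c /= expg1 mulgK.
  rewrite act_eltM // act_elt_expgz // act_elt_incl //.
  by case: (act_pos_le l (repr d) (-1) [::]).
have inf_cs : ((nf c^-1%g).1 <= (nf (c^-1 * run i p)%g).1)%R.
  exact: inf_le_mul_incl.
have [stable|raised] := eqVneq (nf (c^-1 * run i p)%g).1 (nf c^-1%g).1.
  by rewrite stable; rewrite (inf_mul_run2 _ _ _ stable) in c_st.
move: inf_c inf_cs raised.
by case: (nf c^-1) => k w; case: (nf (_ * _)) => k' w' /=; lia.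
Qed.

(** * Left-weighted factorizations *)

Definition greedy_runs (rs : seq (letter * nat)) : bool :=
  all (fun r => 0 < r.2 < L) rs &&
  sorted (fun r r' => r'.1 != iter r.2 (@ordS m.+1) r.1) rs.

Implicit Types rs : seq (letter * nat).

Definition runs_elt k rs : G := expgz Delta k * \prod_(r <- rs) run r.1 r.2.

Lemma left_weighted_runs k rs : greedy_runs rs ->
  left_weighted (runs_elt k rs) (k, [seq run r.1 r.2 | r <- rs]).
Proof.
case/andP=> /allP proper_rs brk_rs; split; first by rewrite /= big_map.
  move=> _ /mapP[r /proper_rs r_proper ->]; have [] := run_proper r.1 r_proper.
  by split=> //; apply: simple_run; lia.
split=> [_ /mapP[r /proper_rs r_proper ->]|n].
  by apply: simple_run; lia.
rewrite size_map => lt_n; pose r0 : letter * nat := (ord0, 0).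
rewrite !(nth_map r0) ?(ltnW lt_n) //.
have := elimT (sortedP r0) brk_rs n lt_n => /= brk.
by apply/is_lgcd_run; rewrite ?proper_rs ?mem_nth ?(ltnW lt_n).
Qed.

(** The converse of [left_weighted_runs]: every left-weighted factorization is a
    greedy list of runs. *)
Lemma left_weightedE x k s : left_weighted x (k, s) ->
  exists rs, [/\ greedy_runs rs, s = [seq run r.1 r.2 | r <- rs] & x = runs_elt k rs].
Proof.
case=> /= def_x proper_s [_ greedy_s].
have [rs [proper_rs def_s]] : exists rs, all (fun r => 0 < r.2 < L) rs /\
    s = [seq run r.1 r.2 | r <- rs].
  elim: s proper_s {def_x greedy_s} => [|a s IH] proper_s; first by exists [::].
  have [|rs [proper_rs ->]] := IH.
    by move=> b s_b; apply: proper_s; rewrite inE s_b orbT.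
  have [simple_a a1 aD] := proper_s a (mem_head _ _).
  have [i [p [p_proper ->]]] := proper_simple_eltP simple_a a1 aD.
  by exists ((i, p) :: rs); rewrite /= p_proper.
exists rs; split=> //; last by rewrite /runs_elt def_x def_s big_map.
rewrite /greedy_runs proper_rs /=; pose r0 : letter * nat := (ord0, 0).
apply/(sortedP r0) => n lt_n /=.
have := greedy_s n; rewrite def_s size_map !(nth_map r0) ?(ltnW lt_n) //.
by move=> /(_ lt_n)/is_lgcd_run; apply; apply: (allP proper_rs);
   rewrite mem_nth // ltnW.
Qed.

Definition runs_word rs : seq letter := flatten [seq sword r.1 r.2 | r <- rs].

Lemma greedy_runs_cons r rs : greedy_runs (r :: rs) ->
  [/\ 0 < r.2 < L, greedy_runs rs &
      ~~ starts (runs_word rs) (iter r.2 (@ordS m.+1) r.1)].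
Proof.
case/andP=> /= /andP[r_proper proper_rs] brk; split=> //.
  by rewrite /greedy_runs proper_rs (path_sorted brk).
case: rs brk proper_rs => //= -[j [|q]] rs //= /andP[brk _] _.
by apply: contra brk => /eqP[->].
Qed.

Lemma reduced_runs_word rs : greedy_runs rs -> reduced l (runs_word rs).
Proof.
elim: rs => //= r rs IH /greedy_runs_cons[/andP[_ lt_rL] good_rs brk].
by apply: reduced_sword; rewrite ?IH.
Qed.

Lemma nb_runs_word rs : greedy_runs rs -> nb_runs (runs_word rs) = size rs.
Proof.
elim: rs => //= -[i [|p]] rs IH /greedy_runs_cons[// _ good_rs brk].
by rewrite -IH // -(nb_runs_sword brk).
Qed.

Lemma nf_runs_elt k rs : greedy_runs rs -> nf (runs_elt k rs) = (k, runs_word rs).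
Proof.
move=> good_rs; rewrite /runs_elt act_eltM //.
have -> : nf (\prod_(r <- rs) run r.1 r.2) = (0%R, runs_word rs).
  elim: rs good_rs => [|r rs IH]; first by rewrite big_nil act_elt1.
  case/greedy_runs_cons=> /andP[_ lt_rL] good_rs brk.
  rewrite big_cons act_eltM // IH // act_elt_run ?reduced_runs_word //.
  by rewrite act_sword_reduced ?reduced_runs_word ?twist0.
by rewrite act_elt_expgz ?reduced_runs_word //; congr pair; lia.
Qed.

(** Uniqueness of the left-weighted factorization: [k] is read on the normal form,
    and the number of factors is the number of maximal runs of its word. *)
Lemma inf_sup_runs_elt k rs : greedy_runs rs ->
  ginf (runs_elt k rs) = k /\ gsup (runs_elt k rs) = (k + (size rs)%:Z)%R.
Proof.
move=> good_rs; have lw := left_weighted_runs k good_rs.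
have /= := xgetI (0%R, [::]) lw; rewrite /ginf /gsup -/(lwf _).
case: (lwf _) => k' s /left_weightedE[rs' [good_rs' -> def_x]] /=.
have := nf_runs_elt k' good_rs'; rewrite -def_x nf_runs_elt // => -[-> def_w].
by rewrite size_map -(nb_runs_word good_rs) -(nb_runs_word good_rs') def_w.
Qed.

(** * Cyclic moves *)

Lemma run_mul i n : run i (n * L) = Delta ^+ n.
Proof.
elim: n i => [|n IH] i; first exact: run0.
by rewrite mulSn runD run_full IH expgS.
Qed.

Lemma run_expgz i p k :
  run i p * expgz Delta k = expgz Delta k * run (twist l k i) p.
Proof. by rewrite -runJ -conjgC. Qed.

(** Two consecutive factors of a power of [x] are separated by [Delta ^ k], and
    the hypothesis says that after moving it away they are consecutive runs. *)
Lemma periodic_single_run k i p :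
  twist l (- k) i = iter p (@ordS m.+1) i -> periodic (expgz Delta k * run i p).
Proof.
move=> closing; set x := _ * _.
have def_i : iter p (@ordS m.+1) (twist l k i) = i.
  by rewrite -twist_iter -closing -twistD addrN twist0.
have powers n : x ^+ n =
    expgz Delta (k * n%:Z) * run (twist l (k * (n%:Z - 1)) i) (n * p).
  elim: n => [|n IH]; first by rewrite mulr0 mul1g run0.
  rewrite expgS IH /x mulgA -(mulgA _ (run i p)) run_expgz mulgA -expgzD -mulgA.
  congr (expgz _ _ * _); first by lia.
  rewrite mulSn runD; congr (run (twist _ _ _) _ * run _ _); first by lia.
  rewrite -[in LHS]def_i twist_iter -twistD.
  by congr (iter _ _ (twist _ _ _)); lia.
exists (L%:Z)%R, (k * L%:Z + p%:Z)%R; split=> //.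
by rewrite [LHS]powers mulnC run_mul expgzD.
Qed.

Lemma greedy_pair i j p q : 0 < p < L -> 0 < q < L ->
  j != iter p (@ordS m.+1) i -> greedy [:: run i p; run j q].
Proof.
move=> p_proper q_proper brk; split=> [a|[|[]] //= _].
  by rewrite !inE => /orP[]/eqP->; apply: simple_run; lia.
exact/is_lgcd_run.
Qed.

Lemma greedy_runs_replace i p i' p' rs :
  greedy_runs ((i, p) :: rs) -> 0 < p' < L ->
  iter p' (@ordS m.+1) i' = iter p (@ordS m.+1) i -> greedy_runs ((i', p') :: rs).
Proof.
case/andP=> /= /andP[_ proper_rs] brk p'_proper same_end.
rewrite /greedy_runs /= p'_proper proper_rs /=.
by case: rs brk {proper_rs} => //= r rs; rewrite same_end.
Qed.

(** Conjugating by the last factor puts it in front of the first one, which it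
    precedes consecutively.  The merged run ends where the first factor ended, so
    greediness with the next factor is preserved. *)
Lemma cyclic_merge k i p j q rs :
  greedy_runs ((i, p) :: rcons rs (j, q)) ->
  twist l (- k) i = iter q (@ordS m.+1) j ->
  exists z, conjugate (runs_elt k ((i, p) :: rcons rs (j, q))) z /\
    ((k < ginf z)%R \/ (gsup z < k + (size rs).+2%:Z)%R).
Proof.
move=> good closing.
have good_ip : greedy_runs ((i, p) :: rs).
  move: good; rewrite /greedy_runs /= all_rcons rcons_path.
  by case/andP=> /andP[-> /andP[_ ->]] /andP[->].
have good_rs : greedy_runs rs by case/greedy_runs_cons: good_ip.
have p_proper : 0 < p < L by case/greedy_runs_cons: good_ip.
have q_proper : 0 < q < L.
  by case/andP: good => /= /andP[_]; rewrite all_rcons => /andP[].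
have def_i : iter q (@ordS m.+1) (twist l k j) = i.
  by rewrite -twist_iter -closing -twistD addrN twist0.
set x := runs_elt _ _; pose z := x ^ (run j q)^-1.
have def_z : z =
    expgz Delta k * (run (twist l k j) (q + p) * \prod_(r <- rs) run r.1 r.2).
  rewrite /z /x /runs_elt big_cons big_rcons /= conjgE invgK runD def_i.
  by rewrite !mulgA mulgK run_expgz.
have end_qp : iter (q + p) (@ordS m.+1) (twist l k j) = iter p (@ordS m.+1) i.
  by rewrite addnC iterD def_i.
exists z; split; first by exists (run j q)^-1.
(* A merged run longer than L is Delta times a proper run, since p, q < L. *)
case: (ltngtP (q + p) L) => [lt_L|gt_L|eq_L].
- have good_z : greedy_runs ((twist l k j, q + p) :: rs).
    by apply: greedy_runs_replace good_ip _ end_qp; lia.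
  right; have [_] := inf_sup_runs_elt k good_z.
  by rewrite {1}/runs_elt big_cons -def_z => ->; rewrite /=; lia.
- have good_z : greedy_runs ((twist l (k + 1) j, q + p - L) :: rs).
    apply: greedy_runs_replace good_ip _ _; first by lia.
    by rewrite addrC twistD twist1 -iterD subnK // ltnW.
  left; have [] := inf_sup_runs_elt (k + 1) good_z.
  have run_qp : run (twist l k j) (q + p) =
      Delta * run (twist l (k + 1) j) (q + p - L).
    rewrite -(run_full (twist l k j)) addrC twistD twist1 -runD subnKC //.
    exact: ltnW.
  by rewrite {1}/runs_elt big_cons expgzS -mulgA [Delta * _]mulgA -run_qp -def_z; lia.
left; have [] := inf_sup_runs_elt (k + 1) good_rs.
have run_qp : run (twist l k j) (q + p) = Delta by rewrite eq_L run_full.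
by rewrite {1}/runs_elt expgzS -mulgA -[X in _ * (X * _)]run_qp -def_z; lia.
Qed.

End Group.

(* The positive integers of the paper are m.+1 and l.+1. *)
Theorem proposition2p7 (m l : nat) (x : circular_group m.+1 l.+1) :
  super_summit_set x x -> rigid x \/ periodic x.
Proof.
case=> _ extremal.
have [no_lw|lw] := pselect (forall kw, ~ left_weighted x kw).
  (* In this case lwf x is its default value, whose word is empty. *)
  by left; left; rewrite /lwf xgetPN.
have {lw}: left_weighted x (lwf x).
  apply: xgetPex; apply: contrapT => no_lw; apply: lw => kw lw_kw.
  by apply: no_lw; exists kw.
case def_lwf: (lwf x) => [k s] /left_weightedE[rs [good_rs def_s def_x]].
have inf_x : ginf x = k by rewrite /ginf def_lwf.
case: rs => [|[i p] rs] in good_rs def_s def_x *.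
  by left; left; rewrite def_lwf def_s.
have init_x : init x = run l (twist l (- k) i) p.
  by rewrite /init /phi_pow inf_x def_lwf def_s /= runJ.
case: (lastP rs) => [|{}rs [j q]] in good_rs def_s def_x *.
  have [p_proper _ _] := greedy_runs_cons good_rs.
  have [closing|brk] := eqVneq (twist l (- k) i) (iter p (@ordS m.+1) i).
    right; rewrite def_x /runs_elt big_seq1; exact: periodic_single_run.
  left; right; rewrite init_x /fin def_lwf def_s /=; exact: greedy_pair.
have [closing|brk] := eqVneq (twist l (- k) i) (iter q (@ordS m.+1) j).
  have [z [conj_z]] := cyclic_merge good_rs closing.
  rewrite -def_x in conj_z; have [] := extremal z conj_z.
  have [_] := inf_sup_runs_elt k good_rs; rewrite -def_x inf_x => ->.
  by rewrite /= size_rcons; lia.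
left; right; rewrite init_x /fin def_lwf def_s /= map_rcons last_rcons.
move: good_rs => /andP[/= /andP[p_proper]]; rewrite all_rcons => /andP[q_proper _] _.
exact: greedy_pair.
Qed.
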